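(* Let $\omega$ be a permutation, $\alpha$ a reduced word of $\omega$, $T_\alpha$ the standard tower tableau of $\alpha$ and $D_\alpha$ the canonical labelling of the Rothe diagram $D_\omega$ associated to $\alpha$. Then $T_\alpha$ is obtained from $D_\alpha$ by pushing all labels up to the corresponding columns and rearranging them in increasing order from bottom to top; that is, for every $c$, the labels in the tower of $T_\alpha$ with index $c$, read from bottom to top, are exactly the labels of $D_\alpha$ in column $c$ of $D_\omega$, arranged in increasing order.
   Context: Permutations are written in one-line notation $\omega=\omega_1\cdots\omega_n$; $s_a=(a,a+1)$ and $\omega s_a$ swaps the entries in positions $a,a+1$; a reduced word of $\omega$ is a word $\alpha_1\cdots\alpha_l$ with $\omega=s_{\alpha_1}\cdots s_{\alpha_l}$, $l$ the number of inversions of $\omega$. A tower diagram is a finite sequence $(\mathcal T_1,\mathcal T_2,\ldots)$ of towers; the $i$-th tower of size $k_i\ge0$ consists of the cells $(i,0),\ldots,(i,k_i-1)$, the cell $(i,j)$ being the unit square $[i-1,i]\times[j,j+1]$ identified with its south-east corner, lying on the diagonal $x+y=i+j$; $i$ is its tower index. Sliding. For a positive integer $a$ and a tail $(\mathcal T_p,\ldots)$ of a tower diagram, $a^{\searrow}(\mathcal T_p,\ldots)$ either adds one cell or terminates: (S1) if no tower $\mathcal T_t$, $t\ge p$, has a cell on $x+y=a-1$: (a) if none has a cell on $x+y=a$, add $(a,0)$; (b) if $(a,0)\in\mathcal T_a$, $(a,1)\notin\mathcal T_a$, terminate; (c) if $(a,0),(a,1)\in\mathcal T_a$, result is $(a+1)^{\searrow}(\mathcal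 T_{a+1},\ldots)$. (S2) Otherwise, with $\mathcal T_i$ ($i\ge p$) the leftmost tower having a cell $(i,a-1-i)$: (a) if $(i,a-i)\notin\mathcal T_i$, add it; (b) if $(i,a-i)\in\mathcal T_i$, $(i,a-i+1)\notin\mathcal T_i$, terminate; (c) if both are in $\mathcal T_i$, result is $(a+1)^{\searrow}(\mathcal T_{i+1},\ldots)$. Sliding $a$ into $\mathcal T$ is $a^{\searrow}(\mathcal T_1,\ldots)$. The standard tower tableau $T_\alpha$ of a reduced word $\alpha$ is obtained by sliding its letters one by one into the empty diagram and labelling the cell created by the $k$-th letter with $k$. Rothe diagram: $D_\omega=\{(i,\omega_j): i<j,\ \omega_i>\omega_j\}$, $(r,c)$ meaning row $r$, column $c$. Canonical labelling: for a reduced word $\alpha=\alpha_1\cdots\alpha_l$ of $\omega$, form $w^{(0)}=\mathrm{id}$, $w^{(r)}=w^{(r-1)}s_{\alpha_r}$ (so $w^{(l)}=\omega$); step $r$ swaps two values. $D_\alpha$ labels the cell $(i,j)\in D_\omega$ (where $j<\omega_i$) by the unique $r$ such that step $r$ swaps the values $\omega_i$ and $j$. *)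

(* Defs.v *)
(* Permutations of {1, ..., n}, n >= 1, are elements of 'S_n.+1 (with n shifted
   by one): position or value k is the ordinal of value k.-1, so the entry
   omega_i is (w (i-1)).+1.  Letters of words, tower indices, column indices
   and labels are nats starting from 1, as is the abscissa of a cell (i, j) of
   a tower diagram; its ordinate j starts from 0. *)
From HB Require Import structures.
From mathcomp Require Import all_boot all_fingroup.

Set Implicit Arguments.
Unset Strict Implicit.
Unset Printing Implicit Defensive.

(* s_a swaps the letters a and a + 1, for 1 <= a <= n. *)
Definition adj_transp (n a : nat) : 'S_n.+1 := tperm (inord a.-1) (inord a).

(* (s * t)%g applies s first, so omega s_a, which swaps the entries in
   positions a and a + 1, is (adj_transp n a * w)%g. *)
Definition word_perm (n : nat) (alpha : seq nat) : 'S_n.+1 :=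
  foldl (fun w a => (adj_transp n a * w)%g) 1%g alpha.

Definition inversions (n : nat) (w : 'S_n.+1) : {set 'I_n.+1 * 'I_n.+1} :=
  [set p : 'I_n.+1 * 'I_n.+1 | (p.1 < p.2) && (w p.2 < w p.1)].

Definition reduced_word (n : nat) (w : 'S_n.+1) (alpha : seq nat) : bool :=
  [&& all (fun a => 1 <= a <= n) alpha,
      word_perm n alpha == w
    & size alpha == #|inversions w| ].

(* A tower diagram is the sequence of its tower sizes k_1, k_2, ...; all the
   towers past the end of the sequence are empty. *)
Definition has_cell (d : seq nat) (i j : nat) : bool :=
  (0 < i) && (j < nth 0 d i.-1).

(* The i-th tower has a cell on x + y = s; it can only be (i, s - i). *)
Definition meets_diag (d : seq nat) (s i : nat) : bool :=
  (i <= s) && has_cell d i (s - i).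

(* a slides into the tail (T_p, T_{p+1}, ...) of d; the result is the cell to
   add, or None for termination.  [again q b] stands for the result of sliding
   b into (T_q, ...).  Towers meeting x + y = s have index at most s. *)
Definition slide_step (again : nat -> nat -> option (nat * nat))
    (d : seq nat) (p a : nat) : option (nat * nat) :=
  match ohead [seq t <- iota p (a - p) | meets_diag d a.-1 t] with
  | None => (* S1 *)
      if ~~ has (meets_diag d a) (iota p (a.+1 - p)) then Some (a, 0)
      else if has_cell d a 0 && has_cell d a 1 then again a.+1 a.+1
      else None
  | Some i => (* S2 *)
      if ~~ has_cell d i (a - i) then Some (i, a - i)
      else if has_cell d i (a - i + 1) then again i.+1 a.+1
      else None
  end.

Fixpoint slide_rec (fuel : nat) (d : seq nat) (p a : nat) :
    option (nat * nat) :=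
  if fuel is f.+1 then slide_step (slide_rec f d) d p a else None.

(* size d + 1 rounds suffice, since p increases at each round and a round with
   p > size d sees only empty towers: see slideE. *)
Definition slide (d : seq nat) (p a : nat) : option (nat * nat) :=
  slide_rec (size d).+1 d p a.

Lemma has_cell_size (d : seq nat) (i j : nat) : has_cell d i j -> i <= size d.
Proof.
case: i => //= i; rewrite /has_cell /=.
by case: (ltnP i (size d)) => // le_di; rewrite nth_default.
Qed.

Lemma slide_step_ext (g h : nat -> nat -> option (nat * nat)) d p a :
  p <= a -> (forall q b, p < q <= (size d).+1 -> q <= b -> g q b = h q b) ->
  slide_step g d p a = slide_step h d p a.
Proof.
move=> le_pa gh; rewrite /slide_step.
case E: (ohead _) => [i|]; last first.
  case: ifP => // _; case: ifP => // /andP[/has_cell_size le_ad _].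
  by apply: gh; rewrite // !ltnS le_pa.
have: i \in [seq t <- iota p (a - p) | meets_diag d a.-1 t].
  by case: (filter _ _) E => //= x s [->]; rewrite mem_head.
rewrite mem_filter mem_iota subnKC // => /and3P[_ le_pi lt_ia].
case: ifP => // _; case: ifP => // /has_cell_size le_id.
by apply: gh; rewrite ?ltnS ?le_pi // ltnW.
Qed.

Lemma slideE (d : seq nat) (p a : nat) :
  0 < p <= a -> slide d p a = slide_step (slide d) d p a.
Proof.
have fuelP f g q b : 0 < f -> 0 < g -> q <= b ->
    (size d).+1 < f + q -> (size d).+1 < g + q ->
    slide_rec f d q b = slide_rec g d q b.
  elim: f g q b => [|f IHf] [|g] q b //= _ _ le_qb ltf ltg.
  apply: slide_step_ext => // r c /andP[lt_qr le_rd] le_rc.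
  have ltfr: (size d).+1 < f + r.
    by apply: leq_trans ltf _; rewrite addSnnS leq_add2l.
  have ltgr: (size d).+1 < g + r.
    by apply: leq_trans ltg _; rewrite addSnnS leq_add2l.
  apply: IHf => //.
    by case: f ltfr {ltf} => //; rewrite add0n ltnNge le_rd.
  by case: g ltgr {ltg} => //; rewrite add0n ltnNge le_rd.
case/andP=> p_gt0 le_pa; rewrite {1}/slide /=.
apply: slide_step_ext => // q b /andP[lt_pq le_qd] le_qb.
have d_gt0: 0 < size d by rewrite -ltnS (leq_trans _ le_qd) // (leq_trans _ lt_pq).
apply: fuelP => //; rewrite -addn1.
  by rewrite ltn_add2l (leq_trans _ lt_pq).
by rewrite addSn addn1 ltnS -addn1 leq_add2l (leq_trans p_gt0) // ltnW.
Qed.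

(* A labelled tower diagram is the sequence of its towers, a tower being the
   sequence of its labels from bottom to top; its shape is [map size T]. *)
Definition tower (T : seq (seq nat)) (c : nat) : seq nat := nth [::] T c.-1.

Definition add_cell (T : seq (seq nat)) (x : nat * nat) (k : nat) :
    seq (seq nat) :=
  set_nth [::] T x.1.-1 (set_nth 0 (tower T x.1) x.2 k).

(* Slides the letters of alpha into T, labelling the new cells k, k+1, ...;
   None if one of the slides terminates. *)
Fixpoint slide_word (T : seq (seq nat)) (k : nat) (alpha : seq nat) :
    option (seq (seq nat)) :=
  if alpha is a :: alpha' then
    if slide (map size T) 1 a is Some x
    then slide_word (add_cell T x k) k.+1 alpha' else None
  else Some T.

(* T_alpha *)
Definition tower_tableau (alpha : seq nat) : option (seq (seq nat)) :=
  slide_word [::] 1 alpha.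

(* D_omega; the pair (r, c) of ordinals is the cell in row r+1, column c+1. *)
Definition rothe (n : nat) (w : 'S_n.+1) : {set 'I_n.+1 * 'I_n.+1} :=
  [set (p.1, w p.2) | p in inversions w].

(* Step r+1 of alpha swaps the values x and y, that is, they are the entries
   of w^(r) in positions a and a + 1, a being the letter of that step. *)
Definition swaps (n : nat) (alpha : seq nat) (r : nat) (x y : 'I_n.+1) : bool :=
  let w := word_perm n (take r alpha) in
  let a := nth 0 alpha r in
  [set w (inord a.-1); w (inord a)] == [set x; y].

(* D_alpha; for alpha a reduced word of w and a cell of D_omega there is
   exactly one such r, so that neither the choice made by pick nor the default
   value 0 matters. *)
Definition canonical_label (n : nat) (w : 'S_n.+1) (alpha : seq nat)
    (x : 'I_n.+1 * 'I_n.+1) : nat :=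
  if [pick r : 'I_(size alpha) | swaps alpha r (w x.1) x.2] is Some r
  then r.+1 else 0.

Definition column_labels (n : nat) (w : 'S_n.+1) (alpha : seq nat) (c : nat) :
    seq nat :=
  [seq canonical_label w alpha x |
     x : 'I_n.+1 * 'I_n.+1 <- enum (rothe w) & x.2.+1 == c].

(* Main.v *)
Require Import Defs.
From mathcomp Require Import all_boot all_fingroup.
From mathcomp Require Import zify.

Set Implicit Arguments.
Unset Strict Implicit.
Unset Printing Implicit Defensive.

(* The size of column c of D_w is the number k_c of values v > c standing to the
   left of c in w.  If w_a = x < y = w_(a+1), then w s_a has y to the left of x,
   so k_x increases by one and the other column sizes do not change; since the
   number of inversions is the sum of the k_c, every step of a reduced word is
   of this kind.  Sliding a into the towers of sizes k_1, k_2, ... amounts to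
   deleting the values 1, 2, ... from w one after the other while following the
   positions of x and y, and the new cell lands on top of tower x. *)

(** * Column sizes and inversions *)

Definition larger_before (n : nat) (w : 'S_n.+1) (c : 'I_n.+1) :
    {set 'I_n.+1} :=
  [set v : 'I_n.+1 | (c < v) && (w^-1 v < w^-1 c)%g].

Lemma card_inversions n (w : 'S_n.+1) :
  #|inversions w| = \sum_c #|larger_before w c|.
Proof.
under eq_bigr do rewrite -sum1_card.
rewrite pair_big_dep /= -sum1_card.
(* An inversion at positions $i<j$ is counted in column [w j], by the element [w i]. *)
rewrite [RHS](reindex (fun p : 'I_n.+1 * 'I_n.+1 => (w p.2, w p.1))) /=;
  last first.
  exists (fun p => (w^-1 p.2, w^-1 p.1))%g => -[x y] _ /=.
    by rewrite !permK.
  by rewrite !permKV.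
by apply: eq_bigl => -[x y]; rewrite !inE /= !permK andbC.
Qed.

(** No position lies strictly between $i$ and $i+1$, so exchanging them can only reverse the
    comparison of these two with each other. *)
Lemma tperm_succ_lt n (i j p q : 'I_n) : j = i.+1 :> nat ->
  (tperm i j p < tperm i j q) =
  ~~ ((p == i) && (q == j)) && ((p == j) && (q == i) || (p < q)).
Proof.
move=> ji; rewrite -!val_eqE /=.
by case: tpermP => [->|->|/eqP+ /eqP+]; case: tpermP => [->|->|/eqP+ /eqP+];
  rewrite -?val_eqE /=; lia.
Qed.

Lemma perm_inv_eq (T : finType) (w : {perm T}) (x y : T) :
  (w^-1%g x == y) = (x == w y).
Proof. by rewrite -(can_eq (permK w)) permKV. Qed.

Lemma larger_before_tperm n (w : 'S_n.+1) (i j c : 'I_n.+1) :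
  j = i.+1 :> nat -> w i < w j ->
  larger_before (tperm i j * w)%g c =
  if c == w i then w j |: larger_before w c else larger_before w c.
Proof.
move=> ji wij; apply/setP=> v.
rewrite (fun_if (fun A : {set 'I_n.+1} => v \in A)) !inE.
rewrite invMg tpermV !permM tperm_succ_lt //.
rewrite !perm_inv_eq.
by case: (eqVneq c (w i)) => [->|nci]; case: (eqVneq v (w j)) => [->|nvj];
  rewrite -?val_eqE /=; move: {ji} (w i) (w j) w^-1%g wij; lia.
Qed.

Lemma notin_larger_before n (w : 'S_n.+1) (i j : 'I_n.+1) :
  i < j -> w j \notin larger_before w (w i).
Proof. by move=> ij; rewrite inE !permK; lia. Qed.

Lemma card_inversions_tperm n (w : 'S_n.+1) (i j : 'I_n.+1) :
  j = i.+1 :> nat -> w i < w j ->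
  #|inversions (tperm i j * w)%g| = #|inversions w|.+1.
Proof.
move=> ji wij; rewrite !card_inversions.
rewrite (bigD1 (w i)) //= [in RHS](bigD1 (w i)) //= larger_before_tperm // eqxx.
rewrite cardsU1 notin_larger_before ?ji // add1n addSn; congr (_ + _).+1.
by apply: eq_bigr => c /negPf nci; rewrite larger_before_tperm // nci.
Qed.

Lemma leq_card_inversions_tperm n (w : 'S_n.+1) (i j : 'I_n.+1) :
  j = i.+1 :> nat ->
  #|inversions (tperm i j * w)%g| <= #|inversions w|.+1 ?= iff (w i < w j).
Proof.
move=> ji; case: (ltnP (w i) (w j)) => [wij|wji].
  by rewrite card_inversions_tperm //; apply/leqif_refl.
have wji': w j < w i.
  by rewrite ltn_neqAle wji val_eqE (inj_eq perm_inj) -val_eqE /=; lia.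
(* At a descent, [w] itself arises from [tperm i j * w] by a step at an ascent. *)
have := @card_inversions_tperm _ (tperm i j * w)%g i j ji.
rewrite !permM tpermL tpermR mulgA tperm2 mul1g => /(_ wji') ->.
by split; lia.
Qed.

(** * Reduced words *)

Lemma word_perm_rcons n alpha a :
  word_perm n (rcons alpha a) = (adj_transp n a * word_perm n alpha)%g.
Proof. by rewrite /word_perm foldl_rcons. Qed.

Lemma inord_pred_succ n a :
  1 <= a <= n -> (inord a : 'I_n.+1) = (inord a.-1 : 'I_n.+1).+1 :> nat.
Proof. by move=> an; rewrite !inordK; lia. Qed.

Lemma leq_card_inversions_word n alpha :
  all (fun a => 1 <= a <= n) alpha ->
  #|inversions (word_perm n alpha)| <= size alpha.
Proof.
elim/last_ind: alpha => [_|alpha a IH].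
  rewrite leqn0 cards_eq0; apply/eqP/setP=> p.
  by rewrite !inE !perm1; lia.
rewrite all_rcons word_perm_rcons size_rcons => /andP[an /IH le_alpha].
apply: leq_trans (leq_card_inversions_tperm _ (inord_pred_succ an)) _.
by rewrite ltnS.
Qed.

(** A letter adds at most one inversion, so a word with as many inversions as letters gains exactly
    one at its last step, which is therefore at an ascent, and its prefix is tight as well. *)
Lemma reduced_word_rcons n (w : 'S_n.+1) alpha a :
  reduced_word w (rcons alpha a) ->
  let u := word_perm n alpha in
  [/\ 1 <= a <= n, reduced_word u alpha, w = (adj_transp n a * u)%g
    & u (inord a.-1) < u (inord a)].
Proof.
rewrite /reduced_word all_rcons word_perm_rcons size_rcons eqxx /=.
case/and3P=> /andP[an alphan] /eqP <- /eqP size_alpha.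
have [] := leq_card_inversions_tperm (word_perm n alpha) (inord_pred_succ an).
have := leq_card_inversions_word alphan.
rewrite alphan an -/(adj_transp n a) -size_alpha eqSS /= => le1 le2 <-.
by split=> //; apply/eqP; lia.
Qed.

(** * Sliding a letter through the towers *)

(* For p < a, the tower T_p of size k meets x + y = a - 1 iff a <= p + k,
   and if it does not then removing it changes nothing for the letter a. *)
Lemma slide_tower d p a : 0 < p <= a ->
  let k := nth 0 d p.-1 in
  slide d p a =
    if p + k < a then slide d p.+1 a
    else if p + k == a then Some (p, k)
    else if p + k == a.+1 then None
    else slide d p.+1 a.+1.
Proof.
move=> /[dup] p_a /andP[p_gt0 le_pa] k; rewrite slideE //.
case: (ltngtP p a) le_pa => // [lt_pa|eq_pa] _; last first.
  rewrite -eq_pa in p_a *.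
  (* For $p=a$ the list of towers tested for $x+y=a-1$ is empty: rule (S1), with cases $k=0$, $k=1$,
     $k\ge2$. *)
  rewrite /slide_step subnn /= subSnn /= /meets_diag leqnn subnn /has_cell.
  rewrite p_gt0 -/k (ltnNge (p + k)) leq_addr /= orbF.
  have -> : (p + k == p) = (k == 0) by lia.
  have -> : (p + k == p.+1) = (k == 1) by lia.
  by case: (k) => [|[|?]].
have iotaS m : p < m -> iota p (m - p) = p :: iota p.+1 (m - p.+1).
  by move=> lt_pm; rewrite subnS; case: (m - p) (subn_gt0 p m) => [|?] //=; lia.
rewrite /slide_step iotaS //=; have [lt_pka|le_apk] := ltnP.
  (* Used for both diagonals that are tested, $m=a-1$ and $m=a$. *)
  have Npa m : a <= m.+1 -> meets_diag d m p = false.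
    by move=> le_am; rewrite /meets_diag /has_cell p_gt0 -/k; lia.
  rewrite Npa ?prednK; try lia.
  rewrite (@slideE d p.+1 a); last by lia.
  by rewrite /slide_step iotaS ?subSS /= ?Npa //; lia.
(* Now $p$ is the leftmost tower on the diagonal, so (S2) applies to it. *)
have -> : meets_diag d a.-1 p = true.
  by rewrite /meets_diag /has_cell p_gt0 -/k; lia.
rewrite /= /has_cell p_gt0 -/k /=.
case: eqP => [<-|ne_pka].
  by rewrite addKn ltnn.
have -> : a - p < k by lia.
have -> : (a - p + 1 < k) = (p + k != a.+1) by lia.
by case: eqP.
Qed.

Lemma card_ltn_ord m i : i <= m -> #|[set k : 'I_m | k < i]| = i.
Proof.
move=> le_im; rewrite -sum1_card.
under eq_bigl do rewrite inE.
by rewrite -(big_ord_widen _ (fun=> 1)) // sum_nat_const card_ord muln1.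
Qed.

(* When the slide reaches the tower of the value p, the letter has become p
   plus the number of values >= p standing to the left of position i. *)
Lemma slide_ascent n (w : 'S_n.+1) (i j : 'I_n.+1) d :
  j = i.+1 :> nat -> w i < w j ->
  (forall c : 'I_n.+1, nth 0 d c = #|larger_before w c|) ->
  slide d 1 i.+1 = Some ((w i).+1, #|larger_before w (w i)|).
Proof.
move=> ji wij dE.
pose B p : {set 'I_n.+1} := [set v : 'I_n.+1 | (p <= v) && (w^-1 v < i)%g].
(* Induction on the number [m] of values still to be deleted before [w i]. Values start from 0, so
   the value $p$ has tower $p+1$. *)
have main m p : p + m = w i ->
    slide d p.+1 (p.+1 + #|B p|) = Some ((w i).+1, #|larger_before w (w i)|).
  elim: m p => [|m IH] p pm; rewrite slide_tower ?leq_addr //=.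
    have -> : p = w i by lia.
    rewrite dE.
    have -> : B (w i) = larger_before w (w i).
      apply/setP=> v; rewrite !inE permK.
      case: (eqVneq v (w i)) => [->|]; first by rewrite permK !ltnn !andbF.
      by rewrite -val_eqE /=; lia.
    by rewrite ltnn eqxx.
  have ltpn : p < n.+1 by have := ltn_ord (w i); lia.
  pose q := Ordinal ltpn; rewrite -[p in nth _ _ p]/(q : nat) dE.
  have nqi : (w^-1 q != i)%g by rewrite perm_inv_eq -val_eqE /=; lia.
  have nqj : (w^-1 q != j)%g by rewrite perm_inv_eq -val_eqE /=; lia.
  have := IH p.+1; have BS v : v != q -> (v \in B p.+1) = (v \in B p).
    by rewrite !inE -val_eqE /=; lia.
  (* If $q$ stands left of $i$, its tower is too short to be met: the letter stays, while [B] loses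
     $q$. *)
  case: (ltnP (w^-1 q)%g i) => [lt_qi|le_iq].
    have -> : B p = q |: B p.+1.
      apply/setP=> v; rewrite in_setU1; have [->|/BS //] := eqVneq v q.
      by rewrite inE /= leqnn lt_qi.
    have qB : q \notin B p.+1 by rewrite inE /= ltnn.
    rewrite cardsU1 qB add1n.
    have le_k : #|larger_before w q| <= #|B p.+1|.
      by apply/subset_leq_card/subsetP=> v; rewrite !inE /=; lia.
    have -> : p.+1 + #|larger_before w q| < p.+1 + #|B p.+1|.+1 by lia.
    by move=> IHp; rewrite -addSnnS; apply: IHp; lia.
  have lt_jq : j < (w^-1 q)%g by move: nqi nqj; rewrite -!val_eqE /=; lia.
  have -> : B p = B p.+1.
    apply/setP=> v; have [->|/BS //] := eqVneq v q.
    by rewrite !inE /=; lia.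
  (* If $q$ stands right of $j$, then [w i], [w j] and all of [B p.+1] are larger and precede it.
     The two extra cells exclude both adding a cell and termination, so the letter grows by one. *)
  have le_k : #|B p.+1|.+2 <= #|larger_before w q|.
    have <- : #|w i |: (w j |: B p.+1)| = #|B p.+1|.+2.
      rewrite !cardsU1 !inE !permK (inj_eq perm_inj) -val_eqE ji /=.
      by rewrite ltnn !andbF; lia.
    apply/subset_leq_card/subsetP=> v; rewrite !inE /=.
    by case/or3P=> [/eqP->|/eqP->|]; rewrite ?permK; lia.
  move: #|larger_before w q| #|B p.+1| le_k => k b le_k IHp.
  case: ltnP => [|_]; first by lia.
  case: eqP => [|_]; first by lia.
  case: eqP => [|_]; first by lia.
  by apply: IHp; lia.
(* Initially [B 0] holds the values at the $i$ positions before $i$, so the letter is $i+1$. *)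
have := main (w i) 0 erefl; suff -> : #|B 0| = i by rewrite add1n.
rewrite -[RHS](card_ltn_ord (ltnW (ltn_ord i))).
rewrite -[RHS](card_preimset _ (@perm_inj _ w^-1%g)).
by apply: eq_card => v; rewrite !inE.
Qed.

(** * Appending a letter to the tableau *)

Lemma slide_word_rcons T k alpha a :
  slide_word T k (rcons alpha a) =
  if slide_word T k alpha is Some T' then
    if slide (map size T') 1 a is Some x
    then Some (add_cell T' x (k + size alpha)) else None
  else None.
Proof.
elim: alpha T k => [|b alpha IH] T k /=; first by rewrite addn0.
by case: slide => // x; rewrite IH addSnnS.
Qed.

Lemma set_nth_size (T : Type) (x0 : T) s y :
  set_nth x0 s (size s) y = rcons s y.
Proof. by elim: s => //= x s ->. Qed.

Lemma tower_add_cell T c k b :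
  tower (add_cell T (c.+1, size (tower T c.+1)) k) b.+1 =
  if b == c then rcons (tower T c.+1) k else tower T b.+1.
Proof. by rewrite /tower /add_cell /= nth_set_nth /= set_nth_size. Qed.

(** * Labels of pairs of values *)

(** [canonical_label] indexed by two values instead of a cell: it no longer mentions [w], so it can
    be followed along the prefixes of the word. *)
Definition swap_label n alpha (v c : 'I_n.+1) : nat :=
  if [pick r : 'I_(size alpha) | swaps alpha r v c] is Some r then r.+1 else 0.

Lemma swaps_rcons n alpha a r (v c : 'I_n.+1) : r < size alpha ->
  swaps (rcons alpha a) r v c = swaps alpha r v c.
Proof.
move=> lt_r; rewrite /swaps nth_rcons lt_r.
by rewrite -cats1 takel_cat // ltnW.
Qed.

Lemma swaps_rcons_size n alpha a (v c : 'I_n.+1) :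
  let u := word_perm n alpha in
  u (inord a.-1) < u (inord a) -> c < v ->
  swaps (rcons alpha a) (size alpha) v c =
  (c == u (inord a.-1)) && (v == u (inord a)).
Proof.
move=> u; rewrite /swaps nth_rcons ltnn eqxx -cats1 take_size_cat // -/u.
move: (u _) (u _) => x y lt_xy lt_cv.
apply/eqP/andP=> [E|[/eqP-> /eqP->]]; last by rewrite setUC.
have := set21 v c; have := set22 v c; rewrite -E !inE.
case/orP=> /eqP ec; case/orP=> /eqP ev; rewrite ec ev ?eqxx //; subst v c; lia.
Qed.

Definition swap_steps n alpha (v c : 'I_n.+1) : seq nat :=
  [seq r <- iota 0 (size alpha) | swaps alpha r v c].

Lemma swap_steps_rcons n alpha a (v c : 'I_n.+1) :
  let u := word_perm n alpha in
  u (inord a.-1) < u (inord a) -> c < v ->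
  swap_steps (rcons alpha a) v c =
  swap_steps alpha v c ++
  nseq ((c == u (inord a.-1)) && (v == u (inord a))) (size alpha).
Proof.
move=> u asc lt_cv; rewrite /swap_steps size_rcons -addn1 iotaD filter_cat /=.
rewrite swaps_rcons_size // -/u; congr (_ ++ _); last by case: ifP.
by apply: eq_in_filter => r; rewrite mem_iota => /andP[_]; apply: swaps_rcons.
Qed.

(** Both sides start at 0 and change only when a letter swaps $c$ and $v$; being at an ascent, that
    step puts $v$ before $c$, where it was not before. *)
Lemma size_swap_steps n (w : 'S_n.+1) alpha (v c : 'I_n.+1) :
  reduced_word w alpha -> c < v ->
  size (swap_steps alpha v c) = (v \in larger_before w c).
Proof.
move=> red_w lt_cv; elim/last_ind: alpha w red_w => [|alpha a IH] w.
  case/and3P=> _ /eqP <- _; rewrite inE /word_perm /= invg1 !perm1.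
  by rewrite (ltnNge v) (ltnW lt_cv) andbF.
case/reduced_word_rcons=> an red_u -> asc.
rewrite swap_steps_rcons // size_cat size_nseq (IH _ red_u).
rewrite larger_before_tperm ?(inord_pred_succ an) //.
case: eqP => [->|_] /=; last by rewrite addn0.
rewrite in_setU1; case: eqP => [->|_] /=; last by rewrite addn0.
by rewrite (negPf (notin_larger_before _ _)) // (inord_pred_succ an).
Qed.

Lemma swap_steps_label n alpha (v c : 'I_n.+1) r :
  swap_steps alpha v c = [:: r] -> swap_label alpha v c = r.+1.
Proof.
move=> steps; have stepE s : (s < size alpha) && swaps alpha s v c = (s == r).
  by rewrite -mem_seq1 -steps mem_filter mem_iota andbC.
rewrite /swap_label; case: pickP => [s sw|no].
  by congr _.+1; apply/eqP; rewrite -stepE ltn_ord.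
have /andP[lt_r sw] : (r < size alpha) && swaps alpha r v c by rewrite stepE.
by have := no (Ordinal lt_r); rewrite /= sw.
Qed.

(** The pair has already used its only swap within [alpha], so the new letter swaps another pair. *)
Lemma swap_label_rcons n (w : 'S_n.+1) alpha a (v c : 'I_n.+1) :
  reduced_word w (rcons alpha a) ->
  let u := word_perm n alpha in
  v \in larger_before u c ->
  swap_label (rcons alpha a) v c = swap_label alpha v c.
Proof.
case/reduced_word_rcons=> an red_u _ asc u v_c.
have lt_cv : c < v by move: v_c; rewrite inE => /andP[].
have := size_swap_steps red_u lt_cv; rewrite v_c.
case steps: (swap_steps alpha v c) => [|r [|? ?]] //= _.
rewrite (swap_steps_label steps); apply: swap_steps_label.
rewrite swap_steps_rcons // steps; case: andP => //= -[/eqP ec /eqP ev].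
move: v_c; rewrite ec ev (negPf (notin_larger_before _ _)) //.
by rewrite (inord_pred_succ an).
Qed.

Lemma swap_label_last n (w : 'S_n.+1) alpha a :
  reduced_word w (rcons alpha a) ->
  let u := word_perm n alpha in
  swap_label (rcons alpha a) (u (inord a)) (u (inord a.-1)) = (size alpha).+1.
Proof.
case/reduced_word_rcons=> an red_u _ asc u; apply: swap_steps_label.
rewrite swap_steps_rcons // !eqxx /=.
rewrite (size0nil (s := swap_steps _ _ _)) // (size_swap_steps red_u) //.
by rewrite (negPf (notin_larger_before _ _)) // (inord_pred_succ an).
Qed.

Lemma swap_label_leq n alpha (v c : 'I_n.+1) :
  swap_label alpha v c <= size alpha.
Proof. by rewrite /swap_label; case: pickP => [r _|_]. Qed.

(** * Labels of a whole column *)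

Definition column_swap_labels n (w : 'S_n.+1) alpha (c : 'I_n.+1) : seq nat :=
  [seq swap_label alpha v c | v <- enum (larger_before w c)].

(** Equality holds only up to order: [enum] lists the column by value, whereas the new label goes
    last, as in [add_cell]. *)
Lemma column_swap_labels_rcons n (w : 'S_n.+1) alpha a (c : 'I_n.+1) :
  let u := word_perm n alpha in
  let s := column_swap_labels u alpha c in
  reduced_word w (rcons alpha a) ->
  perm_eq (column_swap_labels w (rcons alpha a) c)
    (if c == u (inord a.-1) then rcons s (size alpha).+1 else s).
Proof.
move=> u s red; have [an red_u -> asc] := reduced_word_rcons red.
have oldE :
    [seq swap_label (rcons alpha a) v c | v <- enum (larger_before u c)] = s.
  by apply/eq_in_map => v; rewrite mem_enum; exact: (swap_label_rcons red).
rewrite /column_swap_labels larger_before_tperm ?(inord_pred_succ an) // -/u.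
case: eqP => [ec|_]; last by rewrite oldE.
have /(perm_map (fun v => swap_label (rcons alpha a) v c)) :
    perm_eq (enum (u (inord a) |: larger_before u c))
      (u (inord a) :: enum (larger_before u c)).
  apply: uniq_perm => [||v]; first exact: enum_uniq.
    rewrite /= enum_uniq mem_enum ec notin_larger_before //.
    by rewrite (inord_pred_succ an).
  by rewrite mem_enum !inE mem_enum inE.
move=> /perm_trans; apply; rewrite /= oldE {1}ec (swap_label_last red).
by rewrite perm_sym perm_rcons.
Qed.

Lemma perm_column_labels n (w : 'S_n.+1) alpha (c : 'I_n.+1) :
  perm_eq (column_labels w alpha c.+1) (column_swap_labels w alpha c).
Proof.
(* Within a column, a cell is identified with the value [w x.1] of its row. *)
have -> : column_labels w alpha c.+1 =
    [seq swap_label alpha v c |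
       v <- [seq w x.1 |
               x : 'I_n.+1 * 'I_n.+1 <- enum (rothe w) & x.2.+1 == c.+1]].
  rewrite -map_comp; apply/eq_in_map => -[r d]; rewrite mem_filter /=.
  by case/andP=> /eqP [/val_inj ->].
apply/perm_map/uniq_perm; last move=> v.
- rewrite map_inj_in_uniq; first exact/filter_uniq/enum_uniq.
  move=> -[r d] [r' d'].
  rewrite !mem_filter /= => /andP[/eqP[/val_inj->] _] /andP[/eqP[/val_inj->] _].
  by move/perm_inj->.
- exact: enum_uniq.
rewrite mem_enum inE; apply/mapP/andP=> [[[r d]]|[lt_cv lt_vc]].
  rewrite mem_filter mem_enum /= => /andP[/eqP[/val_inj->]].
  case/imsetP=> -[i j]; rewrite inE /= => /andP[lt_ij lt_w] [-> ->] ->.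
  by rewrite !permK.
exists ((w^-1 v)%g, c); last by rewrite permKV.
rewrite mem_filter mem_enum /= eqxx; apply/imsetP.
by exists ((w^-1 v)%g, (w^-1 c)%g); rewrite ?inE /= ?permKV ?lt_vc.
Qed.

Lemma column_labels_nil n (w : 'S_n.+1) alpha c :
  n < c -> column_labels w alpha c.+1 = [::].
Proof.
move=> lt_nc; rewrite /column_labels (_ : filter _ _ = [::]) //.
apply/eqP; rewrite -[_ == _]negbK -has_filter; apply/hasPn=> -[r d] _ /=.
by rewrite eqSS; have := ltn_ord d; lia.
Qed.

(** * Induction on the reduced word *)

(** The first invariant also gives the tower sizes needed for the next slide; towers stay sorted
    because each new label is the largest so far and lands on top. *)
Lemma tower_tableau_swap_labels n (w : 'S_n.+1) alpha :
  reduced_word w alpha ->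
  exists T,
    [/\ tower_tableau alpha = Some T,
        forall c : 'I_n.+1,
          perm_eq (tower T c.+1) (column_swap_labels w alpha c),
        forall c, sorted leq (tower T c.+1)
      & forall c, n < c -> tower T c.+1 = [::]].
Proof.
elim/last_ind: alpha w => [|alpha a IH] w red.
  have [/eqP w1 w0] : word_perm n [::] == w /\ 0 = #|inversions w|.
    by case/and3P: red => _ ? /eqP.
  exists [::]; split=> // c; rewrite /tower ?nth_nil //.
  rewrite /column_swap_labels (_ : larger_before w c = set0) ?enum_set0 //.
  apply/setP=> v; rewrite -w1 !inE /word_perm /= invg1 !perm1; lia.
have [an red_u _ asc] := reduced_word_rcons red.
have [T [TE Tc sortT T0]] := IH _ red_u.
set u := word_perm n alpha in red_u asc Tc.
have sizeT (c : 'I_n.+1) : size (tower T c.+1) = #|larger_before u c|.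
  by rewrite (perm_size (Tc c)) size_map -cardE.
have slideT : slide (map size T) 1 a =
    Some ((u (inord a.-1)).+1, size (tower T (u (inord a.-1)).+1)).
  rewrite sizeT -(slide_ascent (d := map size T) (inord_pred_succ an) asc).
    by congr slide; rewrite -inord_pred_succ // inordK; lia.
  move=> c; rewrite -sizeT /tower /=.
  have [lt_c|le_c] := ltnP c (size T); first by rewrite (nth_map [::]).
  (* Past the end of [T] the default tower is empty, matching the default size 0. *)
  by rewrite !nth_default ?size_map.
exists (add_cell T ((u (inord a.-1)).+1, size (tower T (u (inord a.-1)).+1))
          (size alpha).+1).
split.
- by move: TE; rewrite /tower_tableau slide_word_rcons => ->; rewrite slideT.
- move=> c; rewrite tower_add_cell perm_sym val_eqE.
  apply: perm_trans (column_swap_labels_rcons c red) _; rewrite -/u.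
  case: eqP => [<-|_]; last by rewrite perm_sym.
  by rewrite perm_rcons perm_sym perm_rcons perm_cons.
- move=> c; rewrite tower_add_cell; case: eqP => // _.
  rewrite (sorted_pairwise leq_trans) pairwise_rcons.
  rewrite -(sorted_pairwise leq_trans).
  rewrite sortT andbT (perm_all _ (Tc _)).
  by apply/allP=> _ /mapP[v _ ->]; apply: leqW; apply: swap_label_leq.
- move=> c lt_nc; rewrite tower_add_cell; case: eqP => [ec|_]; last exact: T0.
  by have := ltn_ord (u (inord a.-1)); lia.
Qed.

Theorem mainTheorem6 (n : nat) (w : 'S_n.+1) (alpha : seq nat) :
  reduced_word w alpha ->
  exists T : seq (seq nat),
    tower_tableau alpha = Some T /\
    forall c : nat, 0 < c ->
      tower T c = sort leq (column_labels w alpha c).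
Proof.
case/tower_tableau_swap_labels=> T [TE Tc sortT T0]; exists T; split=> //.
case=> // c _; have [lt_c|lt_nc] := ltnP c n.+1; last first.
  by rewrite T0 // column_labels_nil.
(* The tower is its own sorted form, so it remains to compare two lists up to permutation. *)
rewrite -[LHS](sorted_sort leq_trans (sortT c)).
apply/perm_sortP; [exact: leq_total|exact: leq_trans|exact: anti_leq|].
rewrite perm_sym.
have /perm_trans := perm_column_labels w alpha (Ordinal lt_c); apply.
by rewrite perm_sym; apply: (Tc (Ordinal lt_c)).
Qed.
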